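(* Let $q\ge3$ be an odd prime power, and let $A_q,D_q,G_{5,q},G_{6,q}$ be the cardinalities of the sets $\mathcal A,\mathcal D,\mathcal G_5,\mathcal G_6$ of ordered triples of monic quadratics over $\mathbb F_q$ defined in the context. The numbers of unordered triples $\{u,v,w\}$ in the corresponding four sets are $A_q/6$, $D_q/6$, $G_{5,q}/6$ and $G_{6,q}/6$. Moreover $$\frac{D_q}{A_q}=\frac{q^2-3q+3}{(q-2)(q^2-q+4)}=\frac1q-\frac3{q^3}+O(q^{-4}),$$ $$\frac{G_{5,q}}{A_q}=\frac{3(q^3-6q^2+14q-13)}{(q-2)^2(q^2-q+4)}=\frac3q-\frac3{q^2}+O(q^{-3}),$$ so the non-generic locus $\mathcal D\cup\mathcal G_5$ has density $\dfrac{D_q+G_{5,q}}{A_q}=\dfrac4q-\dfrac3{q^2}+O(q^{-3})$ in $\mathcal A$ (asymptotics as $q\to\infty$ over odd prime powers).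
   Context: For monic quadratics $u=x^2+u_1x+u_0$, $v=x^2+v_1x+v_0$, $w=x^2+w_1x+w_0$ in $\mathbb F_q[x]$ put $$\mathfrak d(u,v,w)=\det\begin{pmatrix} u_0 & u_1 & 1 \\ v_0 & v_1 & 1 \\ w_0 & w_1 & 1 \end{pmatrix}.$$ $\mathcal A$ is the set of ordered triples $(u,v,w)$ of monic quadratics over $\mathbb F_q$ such that $\operatorname{Disc}(u)\operatorname{Disc}(v)\operatorname{Disc}(w)\operatorname{Res}(u,v)\operatorname{Res}(v,w)\operatorname{Res}(w,u)\ne0$ (equivalently $uvw$ is square-free of degree six). $\mathcal D=\{(u,v,w)\in\mathcal A:\mathfrak d(u,v,w)=0\}$. $\mathcal G_5$ is the set of $(u,v,w)\in\mathcal A$ with $\mathfrak d(u,v,w)\neq0$ and at least one of the equalities $u_1=v_1$, $v_1=w_1$, $w_1=u_1$. $\mathcal G_6=\mathcal A\setminus(\mathcal D\cup\mathcal G_5)$. Each of these sets is stable under permuting the three factors; unordered triples are orbits of $S_3$. *)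

(* Defs.v *)
From mathcomp Require Import all_boot all_order all_algebra all_fingroup.
Set Implicit Arguments.
Unset Strict Implicit.
Unset Printing Implicit Defensive.
Import Order.TTheory GRing.Theory Num.Theory.
Local Open Scope ring_scope.

(* {poly_3 F} is the finite type of polynomials of degree at most 2. *)
Definition monic_quadratic (F : finFieldType) (u : {poly_3 F}) : bool :=
  (size u == 3%N) && ((u : {poly F}) \is monic).

Definition disc2 (F : finFieldType) (u : {poly F}) : F :=
  u`_1 ^+ 2 - 4%:R * u`_2 * u`_0.

Definition triple (F : finFieldType) := 3.-tuple {poly_3 F}.

Section Triples.
Variable F : finFieldType.
Implicit Types t : triple F.

Definition fstq t : {poly_3 F} := tnth t 0.
Definition sndq t : {poly_3 F} := tnth t 1.
Definition thdq t : {poly_3 F} := tnth t 2%:R.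

Definition frakd t : F :=
  \det (\matrix_(i < 3, j < 3) [:: (tnth t i)`_0; (tnth t i)`_1; 1]`_j).

Definition tripA : {set triple F} :=
  [set t : triple F |
    let u := fstq t in let v := sndq t in let w := thdq t in
    [&& monic_quadratic u, monic_quadratic v, monic_quadratic w
      & disc2 u * disc2 v * disc2 w
        * resultant u v * resultant v w * resultant w u != 0]].

Definition tripD : {set triple F} := [set t in tripA | frakd t == 0].

Definition tripG5 : {set triple F} :=
  [set t in tripA |
    let u := fstq t in let v := sndq t in let w := thdq t in
    (frakd t != 0) && [|| u`_1 == v`_1, v`_1 == w`_1 | w`_1 == u`_1]].

Definition tripG6 : {set triple F} := tripA :\: (tripD :|: tripG5).

(* The inverse makes this a right action, as the library requires. *)
Definition permute t (s : 'S_3) : triple F :=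
  [tuple tnth t (s^-1%g i) | i < 3].

Fact permute_is_action : is_action [set: 'S_3] permute.
Proof.
apply: is_total_action => [t|t a b]; apply: eq_from_tnth => i;
  by rewrite !tnth_mktuple ?invg1 ?perm1 // invMg permM.
Qed.

Canonical permute_action := Action permute_is_action.

Definition unordered (S : {set triple F}) : {set {set triple F}} :=
  [set orbit permute_action [set: 'S_3] t | t in S].

End Triples.

(* Cardinalities are taken in rat, so that the quotients are genuine. *)
Definition qq (F : finFieldType) : rat := #|F|%:R.
Definition Aq (F : finFieldType) : rat := #|tripA F|%:R.
Definition Dq (F : finFieldType) : rat := #|tripD F|%:R.
Definition G5q (F : finFieldType) : rat := #|tripG5 F|%:R.
Definition G6q (F : finFieldType) : rat := #|tripG6 F|%:R.

(* f = O(g) as #|F| tends to infinity over the finite fields of odd order,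
   i.e. as q tends to infinity over the odd prime powers. *)
Definition bigO_odd (f g : finFieldType -> rat) : Prop :=
  exists (C : rat) (N : nat), forall F : finFieldType,
    odd #|F| -> (N <= #|F|)%N -> `|f F| <= C * `|g F|.

(* Main.v *)
Require Import Defs.
From mathcomp Require Import all_boot all_order all_algebra all_fingroup.
From mathcomp Require Import finfield ring lra zify.
Set Implicit Arguments.
Unset Strict Implicit.
Unset Printing Implicit Defensive.
Import Order.TTheory GRing.Theory Num.Theory.
Local Open Scope ring_scope.

(** Over a field of odd order q every monic quadratic is (X + h)^2 - e for a
unique pair (h, e).  Its linear coefficient is 2h and its discriminant 4e, it is
square-free exactly when e is nonzero, and then it has no root or two roots
according as e is a non-square or a square.  Two distinct monic quadratics are
coprime exactly when they have no common root in F.  So membership in the four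
sets becomes a condition on three points (h, e), and what has to be computed is
three cardinals.  Write
n = (q - 1) / 2; there are q n root-free quadratics and q n split ones, n of
each on every line h = constant.

For the whole of A, fix a coprime square-free pair (u, v) first.  The third
factor is a root-free quadratic different from u and v, or a split one, that is
a two-element set of elements of F, avoiding the roots of u and v
([card_third_factor]).  Its number of values thus depends only on how many of u
and v split, and summing over the pairs gives
A = q (q - 1) (q - 2)^2 (q^2 - q + 4).

For D, the equation d(u, v, w) = 0 says that the three points (u_1, u_0) lie on
an affine line.  If the line is vertical, only the q (q - 1)(q - 2)(q - 3)
ordered choices of distinct nonzero e over a common h remain.  Any other line
consists of the quadratics taking a given value m at a given point r, in other
words of the points (a, (a + r)^2 - m) for a in F.  Here a duality occurs: such
a point is square-free if and only if a is not a root of the quadratic with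
coordinates (r, m), and two distinct such points are coprime if and only if that
same quadratic is square-free.  Choosing three of them is therefore choosing
three elements outside a root set with no or two elements, which gives
q n (q (q - 1)(q - 2) + (q - 2)(q - 3)(q - 4)) triples ([card_line_triples]).

For G_5, an element of A with two equal linear coefficients has d = 0 exactly
when all three are equal.  Hence G_5 is three rotated copies of the triples of A
with u_1 = v_1 that are not vertical, and those with u_1 = v_1 are counted as A
was, over fewer pairs ([card_good_fibre], [card_equal_centers]).

Finally the three factors of an element of A are pairwise coprime, hence
distinct, so that every orbit of the symmetric group has six elements.  The
asymptotic statements follow from the exact quotients, as the error terms are
explicit rational functions of q. *)

Notation point F := (F * F)%type.
Notation point3 F := (F * F * (F * F) * (F * F))%type.

(** * Monic quadratics in completed-square coordinates *)

Section Quadratics.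
Variable F : finFieldType.
Hypothesis oddF : odd #|F|.
Implicit Types (x y z : point F) (a : F).

(** If 2 were zero, the prime characteristic would be 2 and q a power of it. *)
Lemma two_neq0 : 2%:R != 0 :> F.
Proof.
have [p p_pr pcharFp] := finPcharP F.
have cardF : #|F| = (p ^ logn p #|F|)%N := card_pprimeChar pcharFp.
rewrite -(dvdn_pcharf pcharFp); apply/negP => /(dvdn_leq (isT : (0 < 2)%N)) p_le2.
have p2 : p = 2%N by have := prime_gt1 p_pr; lia.
move: oddF; rewrite cardF p2 oddX orbF => /eqP log0.
by have := finNzRing_gt1 F; rewrite cardF p2 log0.
Qed.

(** The polynomial (X + h)^2 - e, given by its coefficients so that its size and
coefficient list are known by computation. *)
Definition quad x : {poly_3 F} :=
  npolyp 3 (Poly [:: x.1 ^+ 2 - x.2; 2%:R * x.1; 1]).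

Lemma polyseq_quad x :
  quad x = [:: x.1 ^+ 2 - x.2; 2%:R * x.1; 1] :> seq F.
Proof.
by rewrite npolypK (@PolyK _ 0) ?size_Poly //= oner_neq0.
Qed.

Lemma monic_quad x : monic_quadratic (quad x).
Proof. by rewrite /monic_quadratic monicE lead_coefE polyseq_quad /= eqxx. Qed.

Lemma quad_inj : injective quad.
Proof.
move=> [h e] [k f] /(congr1 (polyseq \o \val)) /=; rewrite !polyseq_quad /=.
case=> eq0 /(mulfI two_neq0) eqh; rewrite eqh in eq0 *.
by move/addrI/oppr_inj: eq0 => ->.
Qed.

Lemma monic_quadraticP (u : {poly_3 F}) :
  monic_quadratic u -> exists x, u = quad x.
Proof.
case/andP=> /eqP size_u; rewrite monicE lead_coefE size_u /= => /eqP u2.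
exists (u`_1 / 2%:R, (u`_1 / 2%:R) ^+ 2 - u`_0); apply/npolyP => i.
rewrite polyseq_quad; case: i => [|[|[|i]]] /=; first by rewrite opprB addrC subrK.
- by rewrite mulrC divfK // two_neq0.
- by rewrite u2.
by rewrite !nth_default ?size_u.
Qed.

Definition zeros x : {set F} := [set a | (a + x.1) ^+ 2 == x.2].

Lemma root_quad x a : root (quad x) a = (a \in zeros x).
Proof.
rewrite inE rootE /horner polyseq_quad /= -[RHS]subr_eq0; congr (_ == 0); ring.
Qed.

Lemma disc2_quad x : disc2 (quad x) = 4%:R * x.2.
Proof. by rewrite /disc2 polyseq_quad /=; ring. Qed.

(** A common divisor of degree one yields a common root, and one of degree two is
associated to both polynomials, which are monic and hence equal. *)
Lemma coprimep_quad x y :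
  coprimep (quad x) (quad y) = (x != y) && [disjoint zeros x & zeros y].
Proof.
have size_quad z : size (quad z) = 3%N by rewrite polyseq_quad.
have quad_neq0 z : (quad z : {poly F}) != 0 by rewrite -size_poly_eq0 size_quad.
have quad_monic z : (quad z : {poly F}) \is monic by case/andP: (monic_quad z).
apply/idP/andP => [copr | [neq_xy /pred0P disj]].
  split; first by apply: contraTneq copr => ->; rewrite coprimepp size_quad.
  apply/pred0P => a /=; apply/negP => /andP[]; rewrite -!root_quad.
  by move/(coprimep_root copr); rewrite -rootE => /negP.
rewrite coprimep_def; set d := gcdp _ _.
have d_neq0 : d != 0 by rewrite gcdp_eq0 negb_and quad_neq0.
have dx : d %| quad x := dvdp_gcdl _ _.
have dy : d %| quad y := dvdp_gcdr _ _.
have := dvdp_leq (quad_neq0 x) dx; rewrite size_quad.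
have: size d != 0%N by rewrite size_poly_eq0.
case size_d: (size d) => [|[|[|[|k]]]] // _ _.
- have /poly2_root[a da] : size d = 2%N := size_d.
  by have := disj a; rewrite /= -!root_quad !(root_dvdp _ da).
have eqp_d z : d %| quad z -> d %= quad z.
  by move=> dz; rewrite -dvdp_size_eqp // size_d size_quad.
case/eqP: neq_xy; apply/quad_inj/val_inj/eqP.
rewrite -(eqp_monic (quad_monic x) (quad_monic y)).
by rewrite (eqp_trans _ (eqp_d y dy)) // eqp_sym eqp_d.
Qed.
End Quadratics.

(** * Root-free and split quadratics *)

Lemma card_pairs (T U : finType) (A : pred T) (B : T -> pred U) :
  #|[set x : T * U | A x.1 & B x.1 x.2]| =
  (\sum_(t | A t) #|[set u | B t u]|)%N.
Proof.
rewrite -[LHS]sum1dep_card.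
have /= <- := pair_big_dep (idx := 0%N) (op := addn) A B (fun _ _ => 1%N).
by apply: eq_bigr => t _; rewrite sum1dep_card.
Qed.

Lemma card_pairs_const (T U : finType) (A : pred T) (B : T -> pred U) k :
    (forall t, A t -> #|[set u | B t u]| = k) ->
  #|[set x : T * U | A x.1 & B x.1 x.2]| = (#|[set t | A t]| * k)%N.
Proof.
move=> cardB; rewrite card_pairs (eq_bigr (fun=> k)) // -sum_nat_const.
by apply: eq_bigl => t; rewrite inE.
Qed.

Section Count.
Variable F : finFieldType.
Hypothesis oddF : odd #|F|.
Implicit Types (x y z u v w : point F) (a h e : F).
Let n := #|F|./2.

Lemma cardF_half : #|F| = n.*2.+1.
Proof. by rewrite -[LHS]odd_double_half oddF. Qed.

(** [irred] and [splits] are the two ways for a quadratic to be square-free: with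
a double root there is exactly one zero. *)
Definition sqfree x := x.2 != 0.
Definition irred x := zeros x == set0.
Definition splits x := #|zeros x| == 2.
Definition coprimeq x y := (x != y) && [disjoint zeros x & zeros y].

Lemma coprimeq_sym x y : coprimeq x y = coprimeq y x.
Proof. by rewrite /coprimeq eq_sym disjoint_sym. Qed.

Lemma zeros_pair x a : a \in zeros x -> zeros x = [set a; - (2%:R * x.1) - a].
Proof.
rewrite inE => /eqP ax; apply/setP => b; rewrite !inE -ax eqf_sqr.
by rewrite (inj_eq (addIr _)) -(addrC (- a)) -[in X in _ || X](inj_eq (addIr (- x.1))) addrK;
  congr (_ || (_ == _)); ring.
Qed.

Lemma card_zeros x : #|zeros x| = if x.2 == 0 then 1%N else if irred x then 0%N else 2.
Proof.
rewrite /irred; have [r0|[a ra]] := set_0Vmem (zeros x).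
  rewrite r0 cards0 eqxx; case: eqP => // x20.
  by have := in_set0 (- x.1); rewrite -r0 inE x20 addNr expr0n eqxx.
rewrite (negPf (_ : zeros x != set0)); last by apply/set0Pn; exists a.
rewrite (zeros_pair ra) cards2; move: ra; rewrite inE => /eqP <-.
rewrite sqrf_eq0 -(mulrI_eq0 (a + x.1) (mulfI (two_neq0 oddF))).
rewrite -[X in _ = if X == _ then _ else _]opprK oppr_eq0.
rewrite -[in X in nat_of_bool X]subr_eq0.
have -> : a - (- (2%:R * x.1) - a) = 2%:R * (a + x.1) by ring.
by rewrite oppr_eq0; case: eqP.
Qed.

Lemma sqfree_irred_splits x : sqfree x = irred x || splits x.
Proof.
rewrite /sqfree /splits; have := card_zeros x; rewrite /irred -cards_eq0.
by case: (x.2 == 0) => [-> //|]; case: ifP => // _ ->.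
Qed.

Lemma irred_splits x : irred x -> ~~ splits x.
Proof. by rewrite /irred /splits => /eqP ->; rewrite cards0. Qed.

Lemma sum_card_zeros h : (\sum_e #|zeros (h, e)|)%N = #|F|.
Proof.
transitivity (\sum_(a : F) 1)%N; last by rewrite sum1_card.
rewrite [RHS](partition_big (fun a => (a + h) ^+ 2) predT) //=.
by apply: eq_bigr => e _; rewrite -sum1_card; apply: eq_bigl => a; rewrite inE.
Qed.

(** As e varies with h fixed, each a in F is a zero exactly once.  One of the q
zeros belongs to e = 0 and the others come in pairs. *)
Lemma card_splits_fibre h : #|[set e | splits (h, e)]| = n.
Proof.
have := sum_card_zeros h; rewrite (bigD1 0) //= card_zeros eqxx.
rewrite (bigID (fun e => splits (h, e))) /= [X in (_ + (_ + X))%N]big1 => [|e]; last first.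
  case/andP=> e0 /negPf ns; have := sqfree_irred_splits (h, e).
  by rewrite /sqfree e0 ns orbF => /esym/eqP ->; rewrite cards0.
rewrite (eq_bigr (fun=> 2%N)) => [|e /andP[_ /eqP] //].
rewrite (eq_bigl (fun e => e \in [set e | splits (h, e)])) => [|e]; last first.
  rewrite inE andbC andb_idr // => se.
  by have := sqfree_irred_splits (h, e); rewrite se orbT.
by rewrite sum_nat_const cardF_half addn0 muln2 add1n => -[] /double_inj.
Qed.

Lemma card_irred_fibre h : #|[set e | irred (h, e)]| = n.
Proof.
have := cardsC1 (0 : F); rewrite cardF_half /=.
have -> : [set~ 0] = [set e | irred (h, e)] :|: [set e | splits (h, e)].
  by apply/setP => e; rewrite !inE -sqfree_irred_splits.
rewrite cardsU card_splits_fibre (_ : _ :&: _ = set0) ?cards0.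
  by rewrite subn0 -addnn => /addIn.
by apply/setP => e; rewrite !inE; apply/negP => /andP[/irred_splits/negPf->].
Qed.

Lemma card_fibre (P : pred (point F)) h :
  #|[set x | x.1 == h & P x]| = #|[set e | P (h, e)]|.
Proof.
have h_inj : injective (pair h : F -> F * F) by move=> e f [].
rewrite -(card_imset _ h_inj); apply/eq_card => -[k e]; rewrite !inE /=.
apply/andP/imsetP => [[/eqP-> Pe]|[f]]; first by exists e; rewrite ?inE.
by rewrite inE => Pf [-> ->].
Qed.

Lemma card_by_fibre (P : pred (point F)) k :
  (forall h, #|[set e | P (h, e)]| = k) -> #|[set x | P x]| = (#|F| * k)%N.
Proof.
move=> fib.
have := @card_pairs_const _ _ predT (fun h e => P (h, e)) k (fun h _ => fib h).
by rewrite cardsT => <-; apply: eq_card => -[h e]; rewrite !inE.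
Qed.

Lemma card_irred : #|[set x | irred x]| = (#|F| * n)%N.
Proof. exact: card_by_fibre card_irred_fibre. Qed.

Lemma card_splits : #|[set x | splits x]| = (#|F| * n)%N.
Proof. exact: card_by_fibre card_splits_fibre. Qed.

(** The sum of the two zeros is -2h, which determines h and then e. *)
Lemma zeros_inj : {in splits &, injective (@zeros F)}.
Proof.
move=> [h e] [k f] splx _ eqz.
have [a ax] : exists a, a \in zeros (h, e).
  by apply/set0Pn; rewrite -cards_eq0 (eqP splx).
have ay : a \in zeros (k, f) by rewrite -eqz.
have : - (2%:R * h) - a \in zeros (k, f).
  by rewrite -eqz (zeros_pair ax) !inE eqxx orbT.
rewrite (zeros_pair ay) !inE.
case/orP=> [/eqP ha | /eqP/addIr/oppr_inj/(mulfI (two_neq0 oddF)) hk].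
  by move: splx; rewrite /splits -topredE /= /splits (zeros_pair ax) /= ha setUid cards1.
by move: ax ay; rewrite !inE hk /= => /eqP-> /eqP->.
Qed.

(** A split square-free quadratic is the same as a two-element set of roots. *)
Lemma card_splits_within (S : {set F}) :
  #|[set x | splits x & zeros x \subset S]| = 'C(#|S|, 2).
Proof.
rewrite -cards_draws -(card_in_imset (f := @zeros F)) => [|x y]; last first.
  by rewrite !inE => /andP[sx _] /andP[sy _]; apply: zeros_inj.
apply: eq_card => B; rewrite [in RHS]inE; apply/imsetP/andP.
  by case=> x; rewrite inE => /andP[sx sxS] ->.
case=> sBS /cards2P[a [b [neq_ab defB]]].
(* The quadratic (X - a)(X - b). *)
pose x := (- ((a + b) / 2%:R), ((a - b) / 2%:R) ^+ 2).
have ax : a \in zeros x.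
  by rewrite inE; apply/eqP; congr (_ ^+ 2); rewrite /=; field; rewrite two_neq0.
have zx : zeros x = B.
  rewrite (zeros_pair ax) defB; congr [set _; _].
  by rewrite /=; field; rewrite two_neq0.
exists x; last by rewrite zx.
by rewrite inE zx sBS /splits zx defB cards2 neq_ab.
Qed.
End Count.

(** * Square-free triples *)

Section Triples.
Variable F : finFieldType.
Hypothesis oddF : odd #|F|.
Implicit Types (x y z u v w : point F) (a h e : F).
Let q := #|F|.
Let n := #|F|./2.

Lemma coprimeq_irred u v : irred u -> coprimeq u v = (u != v).
Proof. by rewrite /coprimeq -setI_eq0 => /eqP ->; rewrite set0I eqxx andbT. Qed.

Lemma coprimeq_splits u v : splits u -> coprimeq u v = [disjoint zeros u & zeros v].
Proof.
move=> su; rewrite /coprimeq; case: eqVneq => // <-.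
by rewrite -setI_eq0 setIid -cards_eq0 (eqP su).
Qed.

(** A common zero a of (h, e) and (h, f) would give e = (a + h)^2 = f. *)
Lemma coprimeq_fibre u v : u.1 = v.1 -> coprimeq u v = (u.2 != v.2).
Proof.
case: u v => [h e] [_ f] /= <-; rewrite /coprimeq xpair_eqE eqxx /=.
case: eqVneq => //= neq_ef; apply/pred0P => a; rewrite !inE /=.
by apply/negP => /andP[/eqP-> /eqP eq_ef]; case/eqP: neq_ef.
Qed.

(** A root-free w need only differ from u and v; a split w is a pair of roots
outside those of u and v, which are disjoint from each other. *)
Lemma card_third_factor u v : sqfree u -> sqfree v -> coprimeq u v ->
  #|[set w | [&& sqfree w, coprimeq v w & coprimeq w u]]| =
  (q * n - (irred u + irred v) + 'C(q - (#|zeros u| + #|zeros v|), 2))%N.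
Proof.
move=> sfu sfv /andP[neq_uv disj_uv].
pose I := [set w | irred w] :\ u :\ v.
pose J := [set w | splits w & zeros w \subset ~: (zeros u :|: zeros v)].
have -> : [set w | [&& sqfree w, coprimeq v w & coprimeq w u]] = I :|: J.
  apply/setP => w; rewrite !inE (sqfree_irred_splits oddF) (coprimeq_sym v w).
  have [iw|_] := boolP (irred w).
    by rewrite (negPf (irred_splits iw)) andbT !(coprimeq_irred _ iw) /= orbF.
  rewrite !andbF /=; have [sw|//] := boolP (splits w).
  by rewrite !coprimeq_splits // -!setI_eq0 -disjoints_subset -setI_eq0 setIUr setU_eq0 /= andbC.
rewrite cardsU (_ : I :&: J = set0) ?cards0 ?subn0; last first.
  by apply/setP => w; rewrite !inE; apply/negP => /andP[/and3P[_ _ /irred_splits/negPf->]].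
congr (_ + _)%N.
  have := cardsD1 u [set w | irred w]; have := cardsD1 v ([set w | irred w] :\ u).
  rewrite -/I !inE eq_sym neq_uv /= card_irred // -/n -/q => -> ->.
  by rewrite addnA addKn.
rewrite card_splits_within // cardsCs setCK cardsU.
by move: disj_uv; rewrite -setI_eq0 => /eqP ->; rewrite cards0 subn0.
Qed.

Lemma card_zeros_irred u : irred u -> #|zeros u| = 0%N.
Proof. by move/eqP->; rewrite cards0. Qed.

Lemma irredN u : sqfree u -> ~~ irred u = splits u.
Proof.
rewrite (sqfree_irred_splits oddF) => /orP[iu|su]; first by rewrite iu (negPf (irred_splits iu)).
by rewrite su; apply: contraL su; apply: irred_splits.
Qed.

Definition good_pair (p : point F * point F) :=
  [&& sqfree p.1, sqfree p.2 & coprimeq p.1 p.2].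

(** The completions of a pair depend only on which of its members split, so any
family P of pairs contributes through the sizes of its four classes. *)
Lemma card_triples_over (P : pred (point F * point F)) :
  #|[set t : point3 F | P t.1 && good_pair t.1
       & [&& sqfree t.2, coprimeq t.1.2 t.2 & coprimeq t.2 t.1.1]]| =
  (#|[set p | [&& P p, good_pair p, irred p.1 & irred p.2]]| * (q * n - 2 + 'C(q, 2))
   + (#|[set p | [&& P p, good_pair p, irred p.1 & splits p.2]]|
      + #|[set p | [&& P p, good_pair p, splits p.1 & irred p.2]]|)
     * (q * n - 1 + 'C(q - 2, 2))
   + #|[set p | [&& P p, good_pair p, splits p.1 & splits p.2]]| * (q * n + 'C(q - 4, 2)))%N.
Proof.
rewrite (card_pairs (fun p => P p && good_pair p)
          (fun p w => [&& sqfree w, coprimeq p.2 w & coprimeq w p.1])).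
have part (b c : bool) : (\sum_(p | P p && good_pair p
        && (if b then irred p.1 else ~~ irred p.1)
        && (if c then irred p.2 else ~~ irred p.2))
    #|[set w | [&& sqfree w, coprimeq p.2 w & coprimeq w p.1]]| =
    #|[set p | [&& P p, good_pair p, (if b then irred p.1 else splits p.1) &
        (if c then irred p.2 else splits p.2)]]| *
    (q * n - (b + c) + 'C(q - ((if b then 0 else 2) + (if c then 0 else 2)), 2)))%N.
  rewrite -sum_nat_const; apply: eq_big => [p | p].
    rewrite inE; case: (P p) => //=; have [/and3P[sf1 sf2 _]|//] := boolP (good_pair p).
    by rewrite !irredN.
  move=> /andP[/andP[/andP[_ /and3P[sf1 sf2 cp]] i1] i2].
  have {}i1 : irred p.1 = b by case: (b) i1 => // /negPf.
  have {}i2 : irred p.2 = c by case: (c) i2 => // /negPf.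
  by rewrite card_third_factor // i1 i2 !(card_zeros oddF) (negPf sf1) (negPf sf2) i1 i2.
rewrite (bigID (fun p => irred p.1)) (bigID (fun p => irred p.2)) /=.
rewrite [X in (_ + X)%N](bigID (fun p => irred p.2)) /=.
have {part} := (part true true, part true false, part false true, part false false).
by case=> [[[/= -> ->] ->] ->]; rewrite !addn0 !subn0 mulnDl !addnA.
Qed.

(** The size of one class in [card_triples_over], when each first member u has
the same number of partners. *)
Lemma card_good_pairs (R : rel (point F)) (c1 c2 : pred (point F)) k :
    (forall u, c1 u -> sqfree u) -> (forall u, c2 u -> sqfree u) ->
    (forall u, c1 u -> #|[set v | [&& R u v, c2 v & coprimeq u v]]| = k) ->
  #|[set p | R p.1 p.2 & [&& good_pair p, c1 p.1 & c2 p.2]]| =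
  (#|[set u | c1 u]| * k)%N.
Proof.
move=> sf1 sf2 cardR.
rewrite -(card_pairs_const (B := fun u v => [&& R u v, c2 v & coprimeq u v]) cardR).
apply: eq_card => -[u v]; rewrite !inE /good_pair /=.
have [/sf1->|] := boolP (c1 u); last by rewrite !andbF.
by have [/sf2->|] := boolP (c2 v); rewrite ?andbF ?andbT.
Qed.

Lemma irred_sqfree u : irred u -> sqfree u.
Proof. by rewrite (sqfree_irred_splits oddF) => ->. Qed.

Lemma splits_sqfree u : splits u -> sqfree u.
Proof. by rewrite (sqfree_irred_splits oddF) orbC => ->. Qed.

Definition good_triple (t : point3 F) :=
  good_pair t.1 && [&& sqfree t.2, coprimeq t.1.2 t.2 & coprimeq t.2 t.1.1].

Lemma card_irred_others u : irred u -> #|[set v | irred v & coprimeq u v]| = (q * n - 1)%N.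
Proof.
move=> iu; rewrite -/n -/q -(card_irred oddF) [in RHS](cardsD1 u) inE iu addKn.
by apply: eq_card => v; rewrite !inE coprimeq_irred // eq_sym andbC.
Qed.

Lemma coprimeq_irred_splits u v : irred u -> splits v -> coprimeq u v.
Proof.
by move=> iu sv; rewrite coprimeq_irred //; apply: contraTneq sv => <-; apply: irred_splits.
Qed.

Lemma card_splits_others u : splits u -> #|[set v | splits v & coprimeq u v]| = 'C(q - 2, 2).
Proof.
move=> su; have -> : (q - 2)%N = #|~: zeros u|.
  by have := cardsC (zeros u); rewrite (eqP su) -/q => <-; rewrite addKn.
rewrite -card_splits_within //; apply: eq_card => v; rewrite !inE coprimeq_splits //.
by rewrite disjoint_sym disjoints_subset.
Qed.

Lemma card_good : #|[set t | good_triple t]| =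
  (q * n * (q * n - 1) * (q * n - 2 + 'C(q, 2))
   + (q * n * (q * n) + q * n * (q * n)) * (q * n - 1 + 'C(q - 2, 2))
   + q * n * 'C(q - 2, 2) * (q * n + 'C(q - 4, 2)))%N.
Proof.
transitivity #|[set t : point3 F | predT t.1 && good_pair t.1
       & [&& sqfree t.2, coprimeq t.1.2 t.2 & coprimeq t.2 t.1.1]]|.
  by apply: eq_card => t; rewrite !inE.
rewrite card_triples_over.
have cardR c1 c2 k sf1 sf2 := @card_good_pairs (fun _ _ => true) c1 c2 k sf1 sf2.
rewrite (cardR _ _ _ irred_sqfree irred_sqfree card_irred_others).
rewrite (cardR _ _ (q * n)%N irred_sqfree splits_sqfree) => [|u iu]; last first.
  rewrite -card_splits //; apply: eq_card => v; rewrite !inE /=.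
  by apply: andb_idr; apply: coprimeq_irred_splits.
rewrite (cardR _ _ (q * n)%N splits_sqfree irred_sqfree) => [|u su]; last first.
  rewrite -card_irred //; apply: eq_card => v; rewrite !inE /=.
  by apply: andb_idr => iv; rewrite coprimeq_sym coprimeq_irred_splits.
rewrite (cardR _ _ _ splits_sqfree splits_sqfree card_splits_others).
by rewrite card_irred // card_splits.
Qed.

(** The same sum as in [card_good], over pairs with a common h: within a fibre
coprimality is just distinctness, so a class of size n leaves n - 1 partners for
its own members and n for members of the other class. *)
Lemma card_good_fibre : #|[set t | good_triple t & t.1.1.1 == t.1.2.1]| =
  (q * n * (n - 1) * (q * n - 2 + 'C(q, 2))
   + (q * n * n + q * n * n) * (q * n - 1 + 'C(q - 2, 2))
   + q * n * (n - 1) * (q * n + 'C(q - 4, 2)))%N.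
Proof.
transitivity #|[set t : point3 F | (t.1.1.1 == t.1.2.1) && good_pair t.1
       & [&& sqfree t.2, coprimeq t.1.2 t.2 & coprimeq t.2 t.1.1]]|.
  by apply: eq_card => t; rewrite !inE andbC -andbA.
rewrite (card_triples_over (fun p => p.1.1 == p.2.1)).
have cardR c1 c2 k sf1 sf2 := @card_good_pairs (fun u v => u.1 == v.1) c1 c2 k sf1 sf2.
have fibre c u k : #|[set e | c (u.1, e) & u.2 != e]| = k ->
    #|[set v : point F | [&& u.1 == v.1, c v & coprimeq u v]]| = k.
  move=> <-; rewrite -(card_fibre (fun v => c v && (u.2 != v.2))).
  apply: eq_card => v; rewrite !inE eq_sym.
  by case: eqVneq => //= uv1; rewrite coprimeq_fibre.
have same (c : pred (point F)) u : c u -> #|[set e | c (u.1, e)]| = n ->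
    #|[set e | c (u.1, e) & u.2 != e]| = (n - 1)%N.
  move=> cu <-; rewrite [in RHS](cardsD1 u.2) inE -surjective_pairing cu addKn.
  by apply: eq_card => e; rewrite !inE andbC eq_sym.
have other (c c' : pred (point F)) u : c u -> (forall e, c' (u.1, e) -> ~~ c (u.1, e)) ->
    #|[set e | c' (u.1, e)]| = n -> #|[set e | c' (u.1, e) & u.2 != e]| = n.
  move=> cu cc' <-; apply: eq_card => e; rewrite !inE; apply: andb_idr.
  by move/cc'; apply: contraNneq => <-; rewrite -surjective_pairing.
rewrite (cardR _ _ (n - 1)%N irred_sqfree irred_sqfree) => [|u iu]; last first.
  by apply: fibre; apply: same => //; apply: card_irred_fibre.
rewrite (cardR _ _ n irred_sqfree splits_sqfree) => [|u iu]; last first.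
  apply: fibre; apply: other iu _ _ => [e|]; last exact: card_splits_fibre.
  by apply: contraL => /irred_splits.
rewrite (cardR _ _ n splits_sqfree irred_sqfree) => [|u su]; last first.
  apply: fibre; apply: other su _ _ => [e|]; last exact: card_irred_fibre.
  by move/irred_splits.
rewrite (cardR _ _ (n - 1)%N splits_sqfree splits_sqfree) => [|u su]; last first.
  by apply: fibre; apply: same => //; apply: card_splits_fibre.
by rewrite card_irred // card_splits.
Qed.

End Triples.

(** * Collinear triples *)

Definition distinct3 (T : finType) (A : {set T}) (t : T * T * T) :=
  [&& t.1.1 \in A, t.1.2 \in A, t.2 \in A, t.1.1 != t.1.2, t.1.2 != t.2 & t.2 != t.1.1].

Lemma card_distinct3 (T : finType) (A : {set T}) :
  #|[set t | distinct3 A t]| = #|A| ^_ 3.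
Proof.
have cardD1 (B : {set T}) a : a \in B -> #|B :\ a| = #|B|.-1.
  by move=> Ba; rewrite [in RHS](cardsD1 a) Ba.
pose R a b := b \in A :\ a.
have cardR a : a \in A -> #|[set b | R a b]| = #|A|.-1.
  by move=> Aa; rewrite cardsE cardD1.
pose S p c := c \in A :\ p.1 :\ p.2.
have cardS p : (p.1 \in A) && R p.1 p.2 -> #|[set c | S p c]| = #|A|.-2.
  by move=> /andP[Aa Rab]; rewrite cardsE !cardD1.
transitivity (#|A| * #|A|.-1 * #|A|.-2)%N; last by rewrite !ffactnS ffactn0 muln1 mulnA.
have := card_pairs_const (A := fun a => a \in A) cardR; rewrite cardsE => <-.
have := card_pairs_const (A := fun p => (p.1 \in A) && R p.1 p.2) cardS => <-.
apply: eq_card => -[[a b] c]; rewrite !inE /R /S /= !inE /distinct3 /= (eq_sym a b) (eq_sym b c).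
by case: (a \in A); case: (b \in A); case: (c \in A); rewrite ?andbF //= ?andbT.
Qed.

Section Lines.
Variable F : finFieldType.
Hypothesis oddF : odd #|F|.
Implicit Types (x y z u v w : point F) (a h e : F).
Let q := #|F|.
Let n := #|F|./2.

(** A vanishing two by two minor: the three points (h, h^2 - e), whose entries are
half the linear coefficient and the constant one, lie on a line. *)
Definition collinear u v w :=
  (v.1 - u.1) * ((w.1 ^+ 2 - w.2) - (u.1 ^+ 2 - u.2))
    == (w.1 - u.1) * ((v.1 ^+ 2 - v.2) - (u.1 ^+ 2 - u.2)).

(** The quadratics with value m at r, where z = (r, m): those with
(r + h)^2 - e = m, parametrised by h.  These are the non-vertical lines. *)
Definition on_line z a : point F := (a, (a + z.1) ^+ 2 - z.2).
Definition map3 (f : F -> point F) (t : F * F * F) := (f t.1.1, f t.1.2, f t.2).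

(** The difference is (a - b) (a + b + 2r), which is injective in r. *)
Lemma sqr_shift_inj a b r s : a != b ->
  (a + r) ^+ 2 - (b + r) ^+ 2 = (a + s) ^+ 2 - (b + s) ^+ 2 -> r = s.
Proof.
rewrite -subr_eq0 => neq_ab eq_rs; apply/(mulfI (two_neq0 oddF))/(mulfI neq_ab).
by apply/eqP; rewrite -subr_eq0; apply/eqP; move/eqP: eq_rs; rewrite -subr_eq0 => /eqP <-; ring.
Qed.

(** The pairs of a square-free z and an ordered choice of three elements that are
not zeros of z; by [sqfree_on_line] and [coprimeq_on_line] these are the
square-free triples on non-vertical lines. *)
Lemma card_sqfree_lines :
  #|[set y : point F * (F * F * F) | sqfree y.1 & distinct3 (~: zeros y.1) y.2]| =
  (q * n * (q ^_ 3 + (q - 2) ^_ 3))%N.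
Proof.
rewrite (card_pairs _ (fun z t => distinct3 (~: zeros z) t)).
rewrite (eq_bigr (fun z => (q - #|zeros z|) ^_ 3)) => [|z _]; last first.
  by rewrite card_distinct3 cardsCs setCK.
rewrite (bigID (@irred F)) mulnDr /= -{1}(card_irred oddF) -(card_splits oddF) -!sum_nat_const.
congr (_ + _)%N; apply: eq_big => z.
- by rewrite inE andb_idl //; apply: irred_sqfree.
- by case/andP=> _ /card_zeros_irred->; rewrite subn0.
- rewrite inE; have [sfz|] := boolP (sqfree z); first by rewrite irredN.
  by move=> nsf; apply/esym/negbTE; apply: contra nsf; apply: splits_sqfree.
by case/andP=> sfz; rewrite irredN // => /eqP ->.
Qed.

Lemma sqfree_on_line z a : sqfree (on_line z a) = (a \notin zeros z).
Proof. by rewrite /sqfree /= subr_eq0 inE. Qed.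

Lemma coprimeqxx x : coprimeq x x = false.
Proof. by rewrite /coprimeq eqxx. Qed.

(** Two quadratics with the same value m at r differ by a multiple of X - r, so r
is their only possible common zero, and it is one exactly when m = 0. *)
Lemma coprimeq_on_line z a b :
  a != b -> coprimeq (on_line z a) (on_line z b) = sqfree z.
Proof.
case: z => r m neq_ab; rewrite /coprimeq xpair_eqE (negPf neq_ab) /sqfree /=.
have [->|m0] := eqVneq m 0.
  by apply/negbTE/pred0Pn; exists r; rewrite !inE /= !subr0 !(addrC r) !eqxx.
apply/pred0P => x; rewrite !inE /=; apply/negP => /andP[/eqP xa /eqP xb].
have xr : x = r.
  by apply: (sqr_shift_inj neq_ab); rewrite !(addrC _ x) xa xb; ring.
by case/eqP: m0; rewrite -[m](subKr ((a + r) ^+ 2)) -xa xr; ring.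
Qed.

(** The coefficient r is found by solving
(a + r)^2 - e = (b + r)^2 - f, which is linear in r since a and b differ. *)
Lemma line_through u v : u.1 != v.1 ->
  exists z, [/\ u = on_line z u.1, v = on_line z v.1
    & forall w, collinear u v w = (w == on_line z w.1)].
Proof.
case: u v => [a e] [b f] /= neq_ab.
have ba0 : b - a != 0 by rewrite subr_eq0 eq_sym.
have t0 := two_neq0 oddF.
pose r := ((f - e) / (b - a) - (a + b)) / 2%:R.
exists (r, (a + r) ^+ 2 - e); split=> [||[c g]]; rewrite /on_line /=.
- by congr (_, _); ring.
- by congr (_, _); rewrite /r; field; rewrite ?t0 ?ba0.
rewrite /collinear xpair_eqE eqxx /= -subr_eq0 -[RHS]subr_eq0.
rewrite -[RHS](mulrI_eq0 _ (mulfI ba0)) -[RHS]oppr_eq0; congr (_ == 0).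
by rewrite /r; field; rewrite ?t0 ?ba0.
Qed.

Lemma on_line_inj y z a b : a != b ->
  on_line y a = on_line z a -> on_line y b = on_line z b -> y = z.
Proof.
case: y z => [r m] [s l] neq_ab [/= ea] [/= eb].
have rs : r = s.
  apply: (sqr_shift_inj neq_ab).
  transitivity (((a + r) ^+ 2 - m) - ((b + r) ^+ 2 - m)); first by ring.
  by rewrite ea eb; ring.
by move: ea; rewrite rs => /addrI/oppr_inj ->.
Qed.

(** The map sending z and (a, b, c) to three points of the line of z is a
bijection: two of the points determine z by [on_line_inj], and the line exists
by [line_through].  Coprimality makes the third point differ from the first two,
hence, on a non-vertical line, also its first coordinate. *)
Lemma card_line_triples :
  #|[set t | good_triple t & collinear t.1.1 t.1.2 t.2 && (t.1.1.1 != t.1.2.1)]| =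
  (q * n * (q ^_ 3 + (q - 2) ^_ 3))%N.
Proof.
rewrite -card_sqfree_lines.
pose phi (y : point F * (F * F * F)) := map3 (on_line y.1) y.2.
rewrite -(card_in_imset (f := phi)); last first.
  move=> [y [[a b] c]] [z [[a' b'] c']]; rewrite !inE /distinct3 /phi /map3 /=.
  case/and5P=> _ _ _ _ /andP[neq_ab _] _ [].
  move=> <- ea <- eb <- _.
  by rewrite (on_line_inj neq_ab (congr1 (pair a) ea) (congr1 (pair b) eb)).
apply: eq_card => t; rewrite [in LHS]inE; apply/idP/imsetP; last first.
  case=> [[z [[a b] c]]]; rewrite !inE /distinct3 /phi /map3 /=.
  case/and5P=> sz za zb zc /and3P[neq_ab neq_bc neq_ca] ->.
  rewrite /good_triple /good_pair /= !sqfree_on_line !coprimeq_on_line //.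
  rewrite !in_setC in za zb zc.
  rewrite za zb zc sz neq_ab /= andbT.
  by rewrite /collinear /=; apply/eqP; ring.
case: t => [[u v] w]; rewrite /good_triple /good_pair /=.
case/andP=> /andP[/and3P[su sv cuv] /and3P[sw cvw cwu]] /andP[col neq_uv].
have [z [du dv colE]] := line_through neq_uv.
move: col; rewrite colE => /eqP dw.
exists (z, (u.1, v.1, w.1)); last by rewrite /phi /map3 /= -du -dv -dw.
have sz : sqfree z by rewrite -(coprimeq_on_line _ neq_uv) -du -dv.
rewrite inE /distinct3 /= !in_setC -!sqfree_on_line -du -dv -dw sz su sv sw neq_uv /=.
apply/andP; split.
  by apply: contraTneq cvw => vw; rewrite dv vw -dw coprimeqxx.
by apply: contraTneq cwu => wu; rewrite du -wu -dw coprimeqxx.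
Qed.

Definition vertical (t : point3 F) :=
  (t.1.1.1 == t.1.2.1) && (t.2.1 == t.1.1.1).

Lemma card_vertical :
  #|[set t | good_triple t & vertical t]| = (q * (q - 1) ^_ 3)%N.
Proof.
have <- : #|[set y : F * (F * F * F) | predT y.1 & distinct3 [set~ 0] y.2]| =
          (q * (q - 1) ^_ 3)%N.
  rewrite (card_pairs_const (A := predT) (B := fun _ => distinct3 [set~ 0])
            (k := (q - 1) ^_ 3)) ?cardsT // => h _.
  by rewrite card_distinct3 cardsC1 subn1.
pose phi (y : F * (F * F * F)) := map3 (pair y.1) y.2.
rewrite -(card_in_imset (f := phi)); last first.
  by move=> [h [[a b] c]] [k [[a' b'] c']] _ _ [<- <- _ <- _ <-].
apply: eq_card => t; rewrite [in LHS]inE; apply/idP/imsetP; last first.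
  case=> [[h [[a b] c]]]; rewrite inE /distinct3 /= !inE => nz ->.
  by rewrite /good_triple /good_pair /vertical /= !coprimeq_fibre //= !eqxx /=
     /sqfree /= andbT; move: nz; do 5 case: (_ != _).
case: t => [[[h a] [k b]] [l c]]; rewrite /good_triple /good_pair /vertical /=.
case/andP=> gt /andP[/eqP hk /eqP lh]; subst l k.
exists (h, (a, b, c)) => //; move: gt.
by rewrite inE /distinct3 /= !inE !coprimeq_fibre //= /sqfree /=; do 5 case: (_ != _).
Qed.
End Lines.

(** * Triples with two equal linear coefficients *)

Section Degenerate.
Variable F : finFieldType.
Hypothesis oddF : odd #|F|.
Implicit Types (x y z u v w : point F) (a h e : F) (t : point3 F).
Let q := #|F|.
Let n := #|F|./2.

Definition collinear3 t := collinear t.1.1 t.1.2 t.2.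
Definition rot3 t := (t.1.2, t.2, t.1.1).

Lemma rot3_inj : injective rot3.
Proof. by move=> [[u v] w] [[u' v'] w'] [-> -> ->]. Qed.

Lemma good_rot3 t : good_triple (rot3 t) = good_triple t.
Proof.
rewrite /good_triple /good_pair /=.
move: (coprimeq _ _) (coprimeq _ _) (coprimeq _ _) => b1 b2 b3.
by do 3 case: (sqfree _); case: b1; case: b2; case: b3.
Qed.

Lemma collinear_rot3 t : collinear3 (rot3 t) = collinear3 t.
Proof.
case: t => [[[h a] [k b]] [l c]]; rewrite /collinear3 /collinear /=.
by rewrite -subr_eq0 -[RHS]subr_eq0; congr (_ == 0); ring.
Qed.

(** Two distinct points with the same h span a vertical line. *)
Lemma good_collinear_fibre t :
  good_triple t -> t.1.1.1 = t.1.2.1 -> collinear3 t = (t.2.1 == t.1.1.1).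
Proof.
case: t => [[[h a] [k b]] [l c]]; rewrite /good_triple /good_pair /=.
case/andP=> [/and3P[_ _ cuv] _] hk.
move: cuv; rewrite coprimeq_fibre //= -{}hk => neq_ab.
rewrite /collinear3 /collinear /= subrr mul0r eq_sym mulf_eq0 !subr_eq0.
by rewrite (inj_eq (addrI _)) (inj_eq oppr_inj) (eq_sym b) (negPf neq_ab) orbF.
Qed.

Lemma card_collinear : #|[set t | good_triple t & collinear3 t]| =
  (q * (q - 1) ^_ 3 + q * n * (q ^_ 3 + (q - 2) ^_ 3))%N.
Proof.
rewrite -card_vertical // -card_line_triples //.
rewrite -(cardsID [set t : point3 F | t.1.1.1 == t.1.2.1]).
congr (_ + _)%N; apply: eq_card => t; rewrite !inE /vertical; last by rewrite andbC -andbA.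
have [gt|//] := boolP (good_triple t); case: eqVneq => [hk|_] /=; last by rewrite andbF.
by rewrite andbT good_collinear_fibre.
Qed.

Definition equal_centers t :=
  [|| t.1.1.1 == t.1.2.1, t.1.2.1 == t.2.1 | t.2.1 == t.1.1.1].

(** Two equalities among three linear coefficients force the third, and then the
points are collinear.  So a non-collinear triple has at most one equality, and
the three cases are rotations of one another. *)
Lemma card_equal_centers :
  #|[set t | good_triple t & ~~ collinear3 t && equal_centers t]| =
  (3 * (#|[set t : point3 F | good_triple t & t.1.1.1 == t.1.2.1]|
        - #|[set t : point3 F | good_triple t & vertical t]|))%N.
Proof.
pose S := [set t : point3 F |
  good_triple t & (t.1.1.1 == t.1.2.1) && (t.2.1 != t.1.1.1)].
have cardS : #|S| =
    (#|[set t : point3 F | good_triple t & t.1.1.1 == t.1.2.1]|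
    - #|[set t : point3 F | good_triple t & vertical t]|)%N.
  have <- := cardsID [set t : point3 F | t.2.1 == t.1.1.1]
     [set t : point3 F | good_triple t & t.1.1.1 == t.1.2.1].
  rewrite (_ : _ :&: _ = [set t : point3 F | good_triple t & vertical t]).
    by rewrite addKn; apply: eq_card => t; rewrite !inE [RHS]andbC andbA.
  by apply/setP => t; rewrite !inE /vertical andbA.
have rotS k : #|iter k (fun A => rot3 @: A) S| = #|S|.
  by elim: k => //= k <-; rewrite card_imset //; apply: rot3_inj.
have mem_rot t (A : {set point3 F}) :
    (t \in rot3 @: A) = (rot3 (rot3 t) \in A).
  by rewrite -[RHS](mem_imset _ _ rot3_inj); case: t => [[u v] w].
rewrite -cardS.
have -> : [set t | good_triple t & ~~ collinear3 t && equal_centers t] =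
    S :|: (rot3 @: S) :|: (rot3 @: (rot3 @: S)).
  apply/setP => t; rewrite !in_setU !mem_rot !inE !good_rot3 /rot3 /= /equal_centers.
  have [gt|//] := boolP (good_triple t) => /=.
  have := good_collinear_fibre gt.
  have := good_collinear_fibre (t := rot3 t); rewrite good_rot3 collinear_rot3 => /(_ gt).
  have := good_collinear_fibre (t := rot3 (rot3 t)).
  rewrite !good_rot3 !collinear_rot3 => /(_ gt).
  case: t {gt} => [[[h a] [k b]] [l c]] /=.
  have [hk|hk] := eqVneq h k; have [kl|kl] := eqVneq k l; have [lh|lh] := eqVneq l h;
    move=> e1 e2 e3; rewrite ?andbF //=;
    do ?[by rewrite (e1 lh) | by rewrite (e2 kl) | by rewrite (e3 hk)].
rewrite !cardsU.
have -> : S :&: rot3 @: S = set0.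
  apply/setP => -[[u v] w]; rewrite !inE mem_rot !inE /=.
  apply/negP => /andP[/and3P[_ /eqP e1 /eqP ne1] /and3P[_ /eqP e2 /eqP ne2]]; congruence.
have -> : (S :|: rot3 @: S) :&: rot3 @: (rot3 @: S) = set0.
  apply/setP => -[[u v] w]; rewrite !inE !mem_rot !inE /=.
  apply/negP => /andP[/orP[] /and3P[_ /eqP e1 /eqP ne1] /and3P[_ /eqP e2 /eqP ne2]]; congruence.
by rewrite cards0 !subn0 (rotS 1%N) (rotS 2%N) !mulSn mul0n addn0 addnA.
Qed.

End Degenerate.

(** * From coordinates to polynomials *)

Section Transfer.
Variable F : finFieldType.
Hypothesis oddF : odd #|F|.
Implicit Types (t : point3 F) (T : triple F).

Definition qtriple t : triple F := [tuple quad t.1.1; quad t.1.2; quad t.2].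

Lemma qtriple_inj : injective qtriple.
Proof.
move=> [[u v] w] [[u' v'] w'] /(congr1 val) [].
by move=> /(quad_inj oddF)-> /(quad_inj oddF)-> /(quad_inj oddF)->.
Qed.

Lemma resultant_neq0 (p r : {poly F}) :
  p != 0 -> (resultant p r != 0) = coprimep p r.
Proof.
move=> p0; rewrite resultant_eq0 coprimep_def -leqNgt eqn_leq.
by rewrite [(1 <= _)%N]lt0n size_poly_eq0 gcdp_eq0 (negPf p0) andbT.
Qed.

Lemma quad_neq0 (x : point F) : (quad x : {poly F}) != 0.
Proof. by rewrite -size_poly_eq0 polyseq_quad. Qed.

Lemma mem_tripA t : (qtriple t \in tripA F) = good_triple t.
Proof.
case: t => [[u v] w]; rewrite inE /fstq /sndq /thdq !(tnth_nth 0) /= !monic_quad /=.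
rewrite !mulf_eq0 !negb_or !resultant_neq0 ?quad_neq0 // !coprimep_quad // !disc2_quad.
have t4 : (4%:R : F) != 0.
  by rewrite (natrM _ 2 2) mulf_neq0 // two_neq0.
rewrite !mulf_eq0 (negPf t4) /= /good_triple /good_pair /coprimeq /sqfree /= -!andbA.
by do !bool_congr.
Qed.

(** Subtracting the first row, the determinant is -2 times the minor defining
collinearity. *)
Lemma frakd_qtriple t : (frakd (qtriple t) == 0) = collinear3 t.
Proof.
case: t => [[[h a] [k b]] [l c]].
rewrite /frakd (expand_det_col _ ord_max) !big_ord_recl big_ord0 /cofactor.
rewrite !(expand_det_row _ 0) !big_ord_recl !big_ord0 /cofactor !det_mx11 !mxE /=.
rewrite !(tnth_nth 0) /= !polyseq_quad /= /collinear3 /collinear /= -[RHS]subr_eq0.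
rewrite -[RHS](mulrI_eq0 _ (mulfI (two_neq0 oddF))) -[RHS]oppr_eq0 /bump /=.
by congr (_ == 0); ring.
Qed.

Lemma tripA_qtriple T : T \in tripA F -> exists t, T = qtriple t.
Proof.
rewrite inE => /and4P[].
move=> /(monic_quadraticP oddF)[u du] /(monic_quadraticP oddF)[v dv].
move=> /(monic_quadraticP oddF)[w dw] _.
exists (u, v, w); apply: eq_from_tnth => i.
by case: i => [[|[|[|//]]] lti]; rewrite [RHS](tnth_nth 0) /= -?du -?dv -?dw;
  congr (tnth _ _); apply: val_inj.
Qed.

Lemma card_in_tripA (P : pred (triple F)) :
  #|[set T in tripA F | P T]| = #|[set t | good_triple t & P (qtriple t)]|.
Proof.
rewrite -(card_imset _ qtriple_inj); apply: eq_card => T; rewrite [in LHS]inE.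
apply/andP/imsetP => [[AT PT]|[t]]; last by rewrite inE -mem_tripA => /andP[? ?] ->.
by have [t dT] := tripA_qtriple AT; exists t; rewrite // inE -mem_tripA -dT AT.
Qed.

End Transfer.

(** * The action of the symmetric group *)

Section Orbits.
Variable F : finFieldType.
Implicit Types (T : triple F) (s : 'S_3) (S : {set triple F}).

(** All conditions relating the factors have this form; it is visibly invariant
under permutations and reduces to three instances when R is symmetric. *)
Definition pairwise3 (R : rel 'I_3) : bool :=
  [forall i, forall j, (i != j) ==> R i j].

Lemma ord3P (P : 'I_3 -> Prop) : P 0 -> P 1 -> P 2%:R -> forall i, P i.
Proof.
move=> P0 P1 P2 [[|[|[|//]]] lti].
- by rewrite (_ : Ordinal lti = 0) //; apply: val_inj.
- by rewrite (_ : Ordinal lti = 1) //; apply: val_inj.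
by rewrite (_ : Ordinal lti = 2%:R) //; apply: val_inj.
Qed.

Lemma pairwise3E R : symmetric R -> pairwise3 R = [&& R 0 1, R 1 2%:R & R 2%:R 0].
Proof.
move=> symR; apply/forallP/and3P => [allR | [R01 R12 R20]].
  by split; [have /forallP/(_ 1) := allR 0 | have /forallP/(_ 2%:R) := allR 1
            | have /forallP/(_ 0) := allR 2%:R].
by elim/ord3P; apply/forallP; elim/ord3P => //=; rewrite symR.
Qed.

Lemma pairwise3_perm R s : pairwise3 (fun i j => R (s i) (s j)) = pairwise3 R.
Proof.
apply/forallP/forallP => allR i; apply/forallP => j; apply/implyP => neq_ij.
  have /forallP/(_ (s^-1 j)%g)/implyP := allR (s^-1 i)%g.
  by rewrite !permKV => -> //; rewrite (inj_eq perm_inj).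
by have /forallP/(_ (s j))/implyP-> := allR (s i); rewrite ?(inj_eq perm_inj).
Qed.

Definition good_entry (u : {poly_3 F}) := monic_quadratic u && (disc2 u != 0).

Lemma tripAE T : (T \in tripA F) =
  [forall i, good_entry (tnth T i)] &&
  pairwise3 (fun i j => coprimep (tnth T i) (tnth T j)).
Proof.
rewrite pairwise3E => [|i j]; last exact: coprimep_sym.
have -> : [forall i, good_entry (tnth T i)] =
    [&& good_entry (fstq T), good_entry (sndq T) & good_entry (thdq T)].
  by apply/forallP/and3P => [allT | [T0 T1 T2]]; [split; apply: allT | apply: ord3P].
rewrite inE /good_entry -/(fstq T) -/(sndq T) -/(thdq T).
have [/andP[/eqP su _]|] := boolP (monic_quadratic (fstq T)); last by [].
have [/andP[/eqP sv _]|] := boolP (monic_quadratic (sndq T)); last by rewrite !andbF.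
have [/andP[/eqP sw _]|] := boolP (monic_quadratic (thdq T)); last by rewrite !andbF.
by rewrite !mulf_eq0 !negb_or !resultant_neq0 -?size_poly_eq0 ?su ?sv ?sw //= !andbA.
Qed.

Lemma tnth_permute T s i : tnth (permute T s) i = tnth T (s^-1 i)%g.
Proof. by rewrite tnth_mktuple. Qed.

Lemma tripA_permute T s : (permute T s \in tripA F) = (T \in tripA F).
Proof.
rewrite !tripAE -(pairwise3_perm (fun i j => coprimep (tnth T i) (tnth T j)) s^-1).
congr (_ && _).
  apply/forallP/forallP => allT i; last by rewrite tnth_permute.
  by have := allT (s i); rewrite tnth_permute permK.
by apply: eq_forallb => i; apply: eq_forallb => j; rewrite !tnth_permute.
Qed.

(** Permuting the rows changes the determinant by a sign only. *)
Lemma frakd_permute T s : (frakd (permute T s) == 0) = (frakd T == 0).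
Proof.
rewrite /frakd; set M := (X in _ = (\det X == 0)).
rewrite (_ : \matrix_(i, j) _ = row_perm s^-1 M); last first.
  by apply/matrixP => i j; rewrite !mxE !tnth_permute.
by rewrite row_permE det_mulmx det_perm mulf_eq0 signr_eq0.
Qed.

Definition equal_linear T := ~~ pairwise3 (fun i j => (tnth T i)`_1 != (tnth T j)`_1).

Lemma equal_linearE T :
  equal_linear T = [|| (fstq T)`_1 == (sndq T)`_1, (sndq T)`_1 == (thdq T)`_1
                     | (thdq T)`_1 == (fstq T)`_1].
Proof.
rewrite /equal_linear pairwise3E => [|i j]; last by rewrite eq_sym.
by rewrite !negb_and !negbK.
Qed.

Lemma equal_linear_permute T s : equal_linear (permute T s) = equal_linear T.
Proof.
rewrite /equal_linear -(pairwise3_perm (fun i j => (tnth T i)`_1 != (tnth T j)`_1) s^-1).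
by congr (~~ _); apply: eq_forallb => i; apply: eq_forallb => j; rewrite !tnth_permute.
Qed.

(** The stabiliser is trivial: a permutation fixing the triple and moving i would
make two pairwise coprime factors equal, yet a quadratic is not coprime to
itself. *)
Lemma card_orbit_tripA T : T \in tripA F ->
  #|orbit (permute_action F) [set: 'S_3] T| = 6.
Proof.
rewrite tripAE => /andP[/forallP goodT /forallP coprT].
have [] := (card_orbit_stab (permute_action F) [set: 'S_3] T).
rewrite (_ : 'C_[set: 'S_3][T | permute_action F] = 1)%g ?cards1 ?muln1 ?cardsT ?card_Sn //.
apply/trivgP/subsetP => s; rewrite inE => /andP[_ /astab1P fixT].
rewrite inE -(inj_eq invg_inj) invg1; apply/eqP/permP => i; rewrite perm1; apply/eqP.
apply: contraT => /(implyP (forallP (coprT _) i)).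
have -> : tnth T (s^-1 i)%g = tnth T i by rewrite -tnth_permute -[in RHS]fixT.
by have /andP[/andP[/eqP size_i _] _] := goodT i; rewrite coprimepp size_i.
Qed.

Lemma card_unordered S : S \subset tripA F ->
    (forall T s, (permute T s \in S) = (T \in S)) ->
  #|S| = (#|unordered S| * 6)%N.
Proof.
move=> sSA stable; apply: (card_uniform_partition (P := unordered S)); last first.
  by apply: orbit_partition; apply/actsP => s _ T; apply: stable.
by move=> _ /imsetP[T ST ->]; apply/card_orbit_tripA/(subsetP sSA).
Qed.
End Orbits.

(** * The cardinals as polynomials in q *)

Lemma bin2_rat k : 'C(k, 2)%:R = k%:R * (k%:R - 1) / 2%:R :> rat.
Proof.
have: ('C(k, 2) * 2 = k * k.-1)%N by have := bin_ffact k 2; rewrite ffactnS ffactn1.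
move/(congr1 (fun m => m%:R : rat)); rewrite !natrM => /(canRL (mulfK _)) -> //.
by case: k => [|k]; rewrite ?mulr0n ?mul0r // -(natr1 k) addrK.
Qed.

Lemma ffact3_rat k : (k ^_ 3)%:R = k%:R * (k%:R - 1) * (k%:R - 2%:R) :> rat.
Proof.
case: k => [|[|k]]; rewrite ?mulr0n ?mul0r ?subrr ?mulr0 ?mul0r //.
rewrite !ffactnS ffactn0 muln1 /= !natrM mulrA -(natr1 k.+1) -(natr1 k); ring.
Qed.

(** Natural subtraction is exact here except for q - 4 when q = 3, where the
factor in front of the last bracket is zero anyway; hence the two cases. *)
Lemma good_total n : (0 < n)%N -> let q := n.*2.+1 in
  (q * n * (q * n - 1) * (q * n - 2 + 'C(q, 2))
   + (q * n * (q * n) + q * n * (q * n)) * (q * n - 1 + 'C(q - 2, 2))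
   + q * n * 'C(q - 2, 2) * (q * n + 'C(q - 4, 2)))%:R =
  q%:R * (q%:R - 1) * (q%:R - 2%:R) ^+ 2 * (q%:R ^+ 2 - q%:R + 4%:R) :> rat.
Proof.
move=> n0 q.
have qn : q = (n * 2).+1 by rewrite muln2.
move: q qn => q qn.
have qE : q%:R = 2%:R * n%:R + 1 :> rat by rewrite qn -natr1 natrM mulrC.
have q2 : (1 < q)%N by lia.
have qn2 : (1 < q * n)%N by nia.
have [q4|q4] := leqP 4 q.
  by rewrite !(natrD, natrM) !(natrB, natrM) ?bin2_rat ?natrB ?qE ?(ltnW qn2) //; field.
have n1 : n%:R = 1 :> rat by rewrite (_ : n = 1%N) //; lia.
rewrite (_ : q - 4 = 0)%N ?bin0n; last by lia.
by rewrite !(natrD, natrM) !(natrB, natrM) ?bin2_rat ?natrB ?qE ?(ltnW qn2) ?n1 //; field.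
Qed.

Lemma good_fibre_total n : (0 < n)%N -> let q := n.*2.+1 in
  3%:R * ((q * n * (n - 1) * (q * n - 2 + 'C(q, 2))
   + (q * n * n + q * n * n) * (q * n - 1 + 'C(q - 2, 2))
   + q * n * (n - 1) * (q * n + 'C(q - 4, 2)))%:R - (q * (q - 1) ^_ 3)%:R) =
  q%:R * (q%:R - 1) * (3%:R * (q%:R ^+ 3 - 6%:R * q%:R ^+ 2 + 14%:R * q%:R - 13%:R)) :> rat.
Proof.
move=> n0 q.
have qn : q = (n * 2).+1 by rewrite muln2.
move: q qn => q qn.
have qE : q%:R = 2%:R * n%:R + 1 :> rat by rewrite qn -natr1 natrM mulrC.
have q2 : (1 < q)%N by lia.
have qn2 : (1 < q * n)%N by nia.
have [q4|q4] := leqP 4 q.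
  by rewrite !(ffact3_rat, natrD, natrM) !(natrB, natrM)
    ?bin2_rat ?natrB ?qE ?(ltnW qn2) ?(ltnW q2) //; field.
have n1 : n%:R = 1 :> rat by rewrite (_ : n = 1%N) //; lia.
rewrite (_ : q - 4 = 0)%N ?bin0n; last by lia.
by rewrite !(ffact3_rat, natrD, natrM) !(natrB, natrM)
  ?bin2_rat ?natrB ?qE ?(ltnW qn2) ?(ltnW q2) ?n1 //; field.
Qed.

Lemma collinear_total n : (0 < n)%N -> let q := n.*2.+1 in
  (q * (q - 1) ^_ 3 + q * n * (q ^_ 3 + (q - 2) ^_ 3))%:R =
  q%:R * (q%:R - 1) * (q%:R - 2%:R) * (q%:R ^+ 2 - 3%:R * q%:R + 3%:R) :> rat.
Proof.
move=> n0 q.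
have qn : q = (n * 2).+1 by rewrite muln2.
move: q qn => q qn.
have qE : q%:R = 2%:R * n%:R + 1 :> rat by rewrite qn -natr1 natrM mulrC.
have q2 : (1 < q)%N by lia.
by rewrite !(ffact3_rat, natrD, natrM) !(natrB, natrM) ?natrB ?qE ?(ltnW q2) //; field.
Qed.

Section Cardinals.
Variable F : finFieldType.
Hypothesis oddF : odd #|F|.
Let q := qq F.

Lemma qq_ge3 : 3%:R <= q.
Proof.
rewrite ler_nat; have := finNzRing_gt1 F; have := oddF.
by case: #|F| => [|[|[]]].
Qed.

Lemma half_gt0F : (0 < #|F|./2)%N.
Proof. by rewrite half_gt0 finNzRing_gt1. Qed.

Lemma AqE : Aq F = q * (q - 1) * (q - 2%:R) ^+ 2 * (q ^+ 2 - q + 4%:R).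
Proof.
rewrite /Aq (_ : tripA F = [set T in tripA F | true]); last first.
  by apply/setP => T; rewrite inE andbT.
rewrite card_in_tripA // (_ : [set t | _ & _] = [set t | good_triple t]); last first.
  by apply/setP => t; rewrite !inE andbT.
rewrite card_good //; move: (good_total half_gt0F) => /=.
by rewrite -cardF_half.
Qed.

Lemma DqE : Dq F = q * (q - 1) * (q - 2%:R) * (q ^+ 2 - 3%:R * q + 3%:R).
Proof.
rewrite /Dq /tripD card_in_tripA //.
rewrite (_ : [set t | _ & _] = [set t | good_triple t & collinear3 t]); last first.
  by apply/setP => t; rewrite !inE frakd_qtriple.
rewrite card_collinear //; move: (collinear_total half_gt0F) => /=.
by rewrite -cardF_half.
Qed.

Lemma tripG5E : tripG5 F = [set T in tripA F | (frakd T != 0) && equal_linear T].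
Proof. by apply/setP => T; rewrite !inE equal_linearE. Qed.

Lemma G5qE : G5q F =
  q * (q - 1) * (3%:R * (q ^+ 3 - 6%:R * q ^+ 2 + 14%:R * q - 13%:R)).
Proof.
rewrite /G5q tripG5E card_in_tripA //.
rewrite (_ : [set t | _ & _] =
  [set t | good_triple t & ~~ collinear3 t && equal_centers t]); last first.
  apply/setP => -[[u v] w]; rewrite !inE frakd_qtriple // equal_linearE.
  rewrite /fstq /sndq /thdq !(tnth_nth 0) /= !polyseq_quad /= /equal_centers /=.
  by rewrite !(inj_eq (mulfI (two_neq0 oddF))).
rewrite card_equal_centers // natrM natrB; last first.
  by apply/subset_leq_card/subsetP => t; rewrite !inE => /andP[-> /andP[->]].
rewrite card_good_fibre // card_vertical.
by move: (good_fibre_total half_gt0F) => /=; rewrite -cardF_half.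
Qed.

Lemma card_unordered_rat (S : {set triple F}) : S \subset tripA F ->
    (forall T s, (permute T s \in S) = (T \in S)) ->
  #|unordered S|%:R = #|S|%:R / 6%:R :> rat.
Proof. by move=> sSA /(card_unordered sSA) ->; rewrite natrM mulfK. Qed.
End Cardinals.

(** * Error terms *)

Section Asymptotics.
Variable R : realFieldType.
Implicit Types q : R.

Definition Dratio q :=
  (q ^+ 2 - 3%:R * q + 3%:R) / ((q - 2%:R) * (q ^+ 2 - q + 4%:R)).
Definition G5ratio q :=
  3%:R * (q ^+ 3 - 6%:R * q ^+ 2 + 14%:R * q - 13%:R)
    / ((q - 2%:R) ^+ 2 * (q ^+ 2 - q + 4%:R)).

(** Clears denominators, so that an error bound becomes a polynomial inequality
in q. *)
Lemma ratio_bound q (x P Q C : R) k : 0 < q -> 0 < Q -> x = P / Q ->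
  - (C * Q) <= P * q ^+ k <= C * Q -> `|x| <= C * `|q ^- k|.
Proof.
move=> q0 Q0 -> bounds; have qk : 0 < q ^+ k by rewrite exprn_gt0.
rewrite normfV (gtr0_norm qk) normrM normfV (gtr0_norm Q0).
by rewrite ler_pdivlMr // mulrAC ler_pdivrMr // -(gtr0_norm qk) -normrM ler_norml.
Qed.

Lemma den_gt0 q : 3%:R <= q -> 0 < q ^+ 2 - q + 4%:R.
Proof.
move=> q3; have : 0 <= (q - 3%:R) * (q + 2%:R) by apply: mulr_ge0; lra.
by lra.
Qed.

(** The terms in 1/q, 1/q^2 and 1/q^3 cancel and leave the numerator
-q^2 + 18 q - 24 over q^3 (q - 2)(q^2 - q + 4). *)
Lemma Dratio_error q : 3%:R <= q ->
  `|Dratio q - (1 / q - 3%:R / q ^+ 3)| <= 60%:R * `|q ^- 4|.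
Proof.
move=> q3; have q0 : 0 < q by lra.
have q2 : 0 < q - 2%:R by lra.
have Q0 := den_gt0 q3.
apply: (ratio_bound (P := - q ^+ 2 + 18%:R * q - 24%:R)
  (Q := q ^+ 3 * ((q - 2%:R) * (q ^+ 2 - q + 4%:R))) q0).
- by rewrite !mulr_gt0 // exprn_gt0.
- by rewrite /Dratio; field; rewrite !lt0r_neq0.
(* In powers of s = q - 3 all coefficients of the two differences are
   nonnegative. *)
have [s s0 ->] : exists2 s, 0 <= s & q = s + 3%:R.
  by exists (q - 3%:R); rewrite ?subr_ge0 ?subrK.
have pow k : 0 <= s ^+ k by apply: exprn_ge0.
have := (pow 2, pow 3, pow 4, pow 5, pow 6) => -[[[[s2 s3] s4] s5] s6].
by apply/andP; split; lra.
Qed.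

Lemma G5ratio_error q : 3%:R <= q ->
  `|G5ratio q - (3%:R / q - 3%:R / q ^+ 2)| <= 810%:R * `|q ^- 3|.
Proof.
move=> q3; have q0 : 0 < q by lra.
have q2 : 0 < q - 2%:R by lra.
have Q0 := den_gt0 q3.
apply: (ratio_bound (P := 3%:R * (- 3%:R * q ^+ 3 + 19%:R * q ^+ 2 - 36%:R * q + 16%:R))
  (Q := q ^+ 2 * ((q - 2%:R) ^+ 2 * (q ^+ 2 - q + 4%:R))) q0).
- by rewrite !mulr_gt0 // exprn_gt0.
- by rewrite /G5ratio; field; rewrite !lt0r_neq0.
(* In powers of s = q - 3 all coefficients of the two differences are
   nonnegative. *)
have [s s0 ->] : exists2 s, 0 <= s & q = s + 3%:R.
  by exists (q - 3%:R); rewrite ?subr_ge0 ?subrK.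
have pow k : 0 <= s ^+ k by apply: exprn_ge0.
have := (pow 2, pow 3, pow 4, pow 5, pow 6) => -[[[[s2 s3] s4] s5] s6].
by apply/andP; split; lra.
Qed.

(** Adds the two previous estimates; 873 is 60 + 810 plus 3 for the term
-3/q^3, which is absorbed into the error. *)
Lemma sum_error q : 3%:R <= q ->
  `|Dratio q + G5ratio q - (4%:R / q - 3%:R / q ^+ 2)| <= 873%:R * `|q ^- 3|.
Proof.
move=> q3; have q0 : 0 < q by lra.
have := Dratio_error q3; have := G5ratio_error q3.
move: (Dratio q) (G5ratio q) => d g le2 le1.
rewrite (_ : _ - _ = (d - (1 / q - 3%:R / q ^+ 3)) +
   (g - (3%:R / q - 3%:R / q ^+ 2)) - 3%:R * q ^- 3); last first.
  by field; rewrite lt0r_neq0.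
have le43 : `|q ^- 4| <= `|q ^- 3|.
  rewrite !normfV lef_pV2 ?posrE ?normr_gt0 ?expf_neq0 ?lt0r_neq0 //.
  by rewrite !normrX (gtr0_norm q0) ler_weXn2l //; lra.
apply: (le_trans (ler_normB _ _)); rewrite normrM normr_nat.
have := ler_normD (d - (1 / q - 3%:R / q ^+ 3)) (g - (3%:R / q - 3%:R / q ^+ 2)).
by lra.
Qed.
End Asymptotics.

(** * The theorem *)

Section Ratios.
Variable F : finFieldType.
Hypothesis oddF : odd #|F|.
Lemma Dratio_eq : Dq F / Aq F = Dratio (qq F).
Proof.
rewrite DqE // AqE //; have := qq_ge3 oddF; move: (qq F) => x x3.
have Q0 := den_gt0 x3; rewrite /Dratio; field.
by rewrite (lt0r_neq0 Q0) !lt0r_neq0 //; lra.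
Qed.

Lemma G5ratio_eq : G5q F / Aq F = G5ratio (qq F).
Proof.
rewrite G5qE // AqE //; have := qq_ge3 oddF; move: (qq F) => x x3.
have Q0 := den_gt0 x3; rewrite /G5ratio; field.
by rewrite (lt0r_neq0 Q0) !lt0r_neq0 //; lra.
Qed.

End Ratios.

Section Stable.
Variable F : finFieldType.
Implicit Types (T : triple F) (s : 'S_3).

Lemma in_tripD T : (T \in tripD F) = (T \in tripA F) && (frakd T == 0).
Proof. by rewrite inE. Qed.

Lemma in_tripG5 T :
  (T \in tripG5 F) = (T \in tripA F) && ((frakd T != 0) && equal_linear T).
Proof. by rewrite tripG5E inE. Qed.

Lemma in_tripG6 T : (T \in tripG6 F) =
  (T \in tripA F) && ~~ ((T \in tripD F) || (T \in tripG5 F)).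
Proof. by rewrite in_setD in_setU andbC. Qed.

Lemma tripD_permute T s : (permute T s \in tripD F) = (T \in tripD F).
Proof. by rewrite !in_tripD tripA_permute frakd_permute. Qed.

Lemma tripG5_permute T s : (permute T s \in tripG5 F) = (T \in tripG5 F).
Proof.
by rewrite !in_tripG5 tripA_permute frakd_permute equal_linear_permute.
Qed.

Lemma tripG6_permute T s : (permute T s \in tripG6 F) = (T \in tripG6 F).
Proof. by rewrite !in_tripG6 tripA_permute tripD_permute tripG5_permute. Qed.

Lemma card_nongeneric :
  #|tripD F :|: tripG5 F|%:R = Dq F + G5q F.
Proof.
rewrite cardsU (_ : _ :&: _ = set0) ?cards0 ?subn0 ?natrD //.
apply/setP => T; rewrite in_setI in_tripD in_tripG5 in_set0.
by apply/negP => /andP[/andP[_ ->] /and3P[]].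
Qed.
End Stable.

Theorem corollary6p5 :
  (forall F : finFieldType, odd #|F| ->
    let q := qq F in
    [/\ [/\ #|unordered (tripA F)|%:R = Aq F / 6%:R,
            #|unordered (tripD F)|%:R = Dq F / 6%:R,
            #|unordered (tripG5 F)|%:R = G5q F / 6%:R
          & #|unordered (tripG6 F)|%:R = G6q F / 6%:R],
        Dq F / Aq F
          = (q ^+ 2 - 3%:R * q + 3%:R)
            / ((q - 2%:R) * (q ^+ 2 - q + 4%:R)),
        G5q F / Aq F
          = 3%:R * (q ^+ 3 - 6%:R * q ^+ 2 + 14%:R * q - 13%:R)
            / ((q - 2%:R) ^+ 2 * (q ^+ 2 - q + 4%:R))
      & #|tripD F :|: tripG5 F|%:R / Aq F = (Dq F + G5q F) / Aq F])
  /\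
  [/\ bigO_odd (fun F => Dq F / Aq F - (1 / qq F - 3%:R / qq F ^+ 3))
               (fun F => qq F ^- 4),
      bigO_odd (fun F => G5q F / Aq F - (3%:R / qq F - 3%:R / qq F ^+ 2))
               (fun F => qq F ^- 3)
    & bigO_odd (fun F => (Dq F + G5q F) / Aq F
                         - (4%:R / qq F - 3%:R / qq F ^+ 2))
               (fun F => qq F ^- 3)].
Proof.
split; last first.
  split; [exists 60%:R, 0%N | exists 810%:R, 0%N | exists 873%:R, 0%N] => F oddF _.
  - by rewrite (Dratio_eq oddF); exact: Dratio_error (qq_ge3 oddF).
  - by rewrite (G5ratio_eq oddF); exact: G5ratio_error (qq_ge3 oddF).
  - by rewrite mulrDl (Dratio_eq oddF) (G5ratio_eq oddF); exact: sum_error (qq_ge3 oddF).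
move=> F oddF q; split; [|exact: Dratio_eq|exact: G5ratio_eq|].
  split; apply: card_unordered_rat.
  - exact: subxx.
  - exact: tripA_permute.
  - by apply/subsetP => T; rewrite in_tripD => /andP[].
  - exact: tripD_permute.
  - by apply/subsetP => T; rewrite in_tripG5 => /andP[].
  - exact: tripG5_permute.
  - by apply/subsetP => T; rewrite in_tripG6 => /andP[].
  - exact: tripG6_permute.
by rewrite card_nongeneric.
Qed.
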